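(* Let $n\ge 2$ and let $D=(V,A)$ be a strict digraph on $n$ vertices without isolated vertices. Let $\varphi$ be a real function on $\{1,\dots,n-1\}^2$ with $\varphi_{ij}=\varphi_{ji}$, where $\varphi_{ij}=\varphi(i,j)$, and let $I(D)=\frac12\sum_{uv\in A}\varphi(d_u^+,d_v^-)$. Put $M_{ij}=\frac{n-1}{2}\left(\frac1i+\frac1j\right)\varphi_{n-1,n-1}$ and $S_3=\{(i,j)\mid 1\le i\ne j\le n-1\}$. Then: (i) If $\varphi_{ij}>M_{ij}$ for all $(i,j)\in S_3$ and $i\varphi_{ii}=(n-1)\varphi_{n-1,n-1}$ for $1\le i\le n-2$, then $I(D)\ge\frac14 n(n-1)\varphi_{n-1,n-1}$, with equality if and only if $n_0=n$ and $p_{ij}=0$ for all $(i,j)\in S_3$, i.e., if and only if every arc $uv$ of $D$ satisfies $d_u^+=d_v^-$ and every vertex of $D$ has out-degree $0$ or in-degree $0$. (ii) If $\varphi_{ij}<M_{ij}$ for all $(i,j)\in S_3$ and $i\varphi_{ii}=(n-1)\varphi_{n-1,n-1}$ for $1\le i\le n-2$, then $I(D)\le\frac12 n(n-1)\varphi_{n-1,n-1}$, with equality if and only if $n_0=0$ and $p_{ij}=0$ for all $(i,j)\in S_3$, i.e., if and only if every arc $uv$ of $D$ satisfies $d_u^+=d_v^-$ and every vertex of $D$ has positive out-degree and positive in-degree.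
   Context: A digraph $D=(V,A)$ is strict: it has no loops and at most one arc from $u$ to $v$ for each ordered pair of distinct vertices. $d_u^+$ and $d_u^-$ denote the out-degree and in-degree of $u$; a vertex is isolated if $d_u^+=d_u^-=0$. For $1\le i,j\le n-1$, $a_{ij}$ is the number of arcs $uv\in A$ with $d_u^+=i$ and $d_v^-=j$. Set $p_{ij}=a_{ij}+a_{ji}$ for $i\neq j$ and $p_{ii}=a_{ii}$. $n_0$ denotes the number of vertices of out-degree $0$ plus the number of vertices of in-degree $0$.
   Formalization: The formal theorem adds the hypothesis φ_{n-1,n-1} > 0; without it both parts fail, e.g. for n = 2 and φ_{11} ≤ 0, (i) fails for the complete digraph and (ii) for the single arc. *)

(* Defs.v *)
From mathcomp Require Import all_boot all_order all_algebra.

Set Implicit Arguments.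
Unset Strict Implicit.
Unset Printing Implicit Defensive.

Import Order.TTheory GRing.Theory Num.Theory.

Local Open Scope ring_scope.

(* As a relation, the arc set has at most one arc per ordered pair of vertices;
   opposite arcs are allowed. *)
Record strict_digraph (V : finType) := StrictDigraph {
  arc :> rel V;
  arc_irrefl : irreflexive arc
}.

Section Digraph.

Context (V : finType) (D : strict_digraph V).

Definition outdeg (u : V) : nat := #|[set v | D u v]|.

Definition indeg (u : V) : nat := #|[set v | D v u]|.

Definition isolated (u : V) : bool := (outdeg u == 0%N) && (indeg u == 0%N).

Definition arc_count (i j : nat) : nat :=
  #|[set uv : V * V | [&& D uv.1 uv.2, outdeg uv.1 == i & indeg uv.2 == j]]|.

Definition pair_count (i j : nat) : nat :=
  if i == j then arc_count i i else (arc_count i j + arc_count j i)%N.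

(* A vertex with both degrees zero counts twice. *)
Definition zero_degree_count : nat :=
  (#|[set u | outdeg u == 0%N]| + #|[set u | indeg u == 0%N]|)%N.

(* The arguments of phi are at most #|V| - 1 and at least 1, so only the values
   of phi on {1, ..., #|V| - 1}^2 matter. *)
Definition vdb_index (R : realFieldType) (phi : nat -> nat -> R) : R :=
  2^-1 * \sum_(uv : V * V | D uv.1 uv.2) phi (outdeg uv.1) (indeg uv.2).

End Digraph.

Definition vdb_M (R : realFieldType) (n : nat) (phi : nat -> nat -> R)
    (i j : nat) : R :=
  (n - 1)%:R / 2 * (i%:R^-1 + j%:R^-1) * phi (n - 1)%N (n - 1)%N.

Definition S3 (n i j : nat) : bool :=
  [&& (1 <= i <= n - 1)%N, (1 <= j <= n - 1)%N & i != j].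

(* Main.v *)
(** Every vertex [u] of positive out-degree contributes [1] to the sum of
    [1 / outdeg u] over the arcs [uv], and dually for in-degrees; hence
    [1 / outdeg u + 1 / indeg v] sums over the arcs to [2 n - n_0].
    The weights [M_ij] are chosen so that [2 I(D)] differs from
    [c / 2 * (2 n - n_0)], with [c = (n - 1) phi_(n-1,n-1)], by the sum of
    [phi_ij - M_ij] over the arcs, whose terms vanish for [i = j] and have a
    constant strict sign for [i <> j].  Both bounds follow from [0 <= n_0 <= n],
    the second inequality because no vertex is isolated. *)

Require Import Defs.
From mathcomp Require Import all_boot all_order all_algebra.
From mathcomp Require Import zify ring lra.

Set Implicit Arguments.
Unset Strict Implicit.
Unset Printing Implicit Defensive.

Import Order.TTheory GRing.Theory Num.Theory.

Local Open Scope ring_scope.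

(** An arbitrary relation is allowed so that the count applies both to the arcs and to their
    converse, covering out-degrees and in-degrees alike. *)
Lemma sum_inv_card_rel (F : numFieldType) (V : finType) (e : rel V) :
  \sum_u \sum_(v | e u v) (#|[set w | e u w]|%:R^-1 : F) =
    #|V|%:R - #|[set u | #|[set w | e u w]| == 0%N]|%:R.
Proof.
have -> : #|V| =
    (#|[set u | #|[set w | e u w]| == 0%N]| +
     #|[set u | #|[set w | e u w]| != 0%N]|)%N.
  rewrite -(cardsC [set u | #|[set w | e u w]| == 0%N]); congr addn.
  by apply: eq_card => u; rewrite !inE.
rewrite natrD [RHS]addrC addKr -[in RHS]sum1_card natr_sum.
rewrite [RHS]big_mkcond; apply: eq_bigr => u _.
rewrite sumr_const inE !cardsE -[LHS]mulr_natl.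
by case: eqP => [-> | /eqP d0] /=; rewrite ?mul0r // divff // pnatr_eq0.
Qed.

Section StrictDigraph.

Context (V : finType) (D : strict_digraph V).

Lemma outdeg_ltn (u : V) : (outdeg D u < #|V|)%N.
Proof.
rewrite -cardsT; apply: proper_card; apply/properP; split; first exact/subsetP.
by exists u; rewrite ?inE // arc_irrefl.
Qed.

Lemma indeg_ltn (u : V) : (indeg D u < #|V|)%N.
Proof.
rewrite -cardsT; apply: proper_card; apply/properP; split; first exact/subsetP.
by exists u; rewrite ?inE // arc_irrefl.
Qed.

Lemma outdeg_gt0 (u v : V) : D u v -> (0 < outdeg D u)%N.
Proof. by move=> Duv; apply/card_gt0P; exists v; rewrite inE. Qed.

Lemma indeg_gt0 (u v : V) : D u v -> (0 < indeg D v)%N.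
Proof. by move=> Duv; apply/card_gt0P; exists u; rewrite inE. Qed.

Lemma sum_arc_inv_degrees (F : numFieldType) :
  \sum_(uv : V * V | D uv.1 uv.2)
      ((outdeg D uv.1)%:R^-1 + (indeg D uv.2)%:R^-1 : F) =
    2 * #|V|%:R - (zero_degree_count D)%:R.
Proof.
rewrite big_split /=.
rewrite -(pair_big_dep xpredT D (fun u _ => (outdeg D u)%:R^-1 : F)) /=.
rewrite -(pair_big_dep xpredT D (fun _ v => (indeg D v)%:R^-1 : F)) /=.
(* Summing over heads first turns the in-degree half into the same count for the converse
   relation. *)
rewrite sum_inv_card_rel (exchange_big_dep xpredT) //=.
rewrite (sum_inv_card_rel F (fun v u => D u v)) natrD.
by rewrite /outdeg /indeg; ring.
Qed.

Lemma zero_degree_count_eq0 :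
  zero_degree_count D = 0%N <->
    forall u : V, (0 < outdeg D u)%N /\ (0 < indeg D u)%N.
Proof.
rewrite /zero_degree_count; split=> [/eqP | pos].
  rewrite addn_eq0 !cards_eq0 => /andP[/eqP out0 /eqP in0] u.
  rewrite !lt0n; split; apply/negP => d0.
    by have := in_set0 u; rewrite -out0 inE d0.
  by have := in_set0 u; rewrite -in0 inE d0.
by apply/eqP; rewrite addn_eq0 !cards_eq0; apply/andP; split; apply/eqP/setP=> u;
  rewrite !inE; apply/negbTE; rewrite -lt0n; case: (pos u).
Qed.

(** Without isolated vertices, the sets of vertices of out-degree 0 and of in-degree 0 are disjoint,
    so their sizes add up to the size of their union. *)
Lemma zero_degree_count_card (noiso : forall u : V, ~~ isolated D u) :
  zero_degree_count D = #|[set u | (outdeg D u == 0%N) || (indeg D u == 0%N)]|.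
Proof.
rewrite /zero_degree_count -cardsUI -[RHS]addn0; congr addn.
  by apply: eq_card => u; rewrite !inE.
by apply: eq_card0 => u; rewrite !inE; apply/negbTE/noiso.
Qed.

Lemma zero_degree_count_leq (noiso : forall u : V, ~~ isolated D u) :
  (zero_degree_count D <= #|V|)%N.
Proof. by rewrite zero_degree_count_card // max_card. Qed.

Lemma zero_degree_count_eq_card (noiso : forall u : V, ~~ isolated D u) :
  zero_degree_count D = #|V| <->
    forall u : V, outdeg D u = 0%N \/ indeg D u = 0%N.
Proof.
rewrite zero_degree_count_card //; split=> [cardE u | zero].
  have /setP/(_ u) : [set u | (outdeg D u == 0%N) || (indeg D u == 0%N)] = setT.
    by apply/eqP; rewrite eqEcard subsetT cardsT cardE leqnn.
  by rewrite !inE => /orP[] /eqP; [left | right].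
rewrite -cardsT; apply: eq_card => u; rewrite !inE.
by case: (zero u) => ->; rewrite ?orbT.
Qed.

(** An arc gives its tail a positive out-degree and its head a positive in-degree, and the lack of
    loops keeps both below [n]. Hence an arc with unequal degrees is always counted by some pair in
    [S3]. *)
Lemma pair_count_S3_eq0 (n : nat) (cardV : #|V| = n) :
  (forall i j : nat, S3 n i j -> pair_count D i j = 0%N) <->
    (forall u v : V, D u v -> outdeg D u = indeg D v).
Proof.
split=> [pc0 u v Duv | degE i j /and3P[_ _ neq_ij]].
  apply/eqP; apply: contraT => neq_d.
  have: S3 n (outdeg D u) (indeg D v).
    have := (outdeg_ltn u, indeg_ltn v, outdeg_gt0 Duv, indeg_gt0 Duv).
    by rewrite cardV /S3 neq_d => -[[[]]]; lia.
  move/pc0; rewrite /pair_count (negbTE neq_d) => /eqP.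
  rewrite addn_eq0 => /andP[/eqP/cards0_eq/setP/(_ (u, v))].
  by rewrite !inE /= Duv !eqxx.
have arc0 k l : k != l -> arc_count D k l = 0%N.
  move=> neq_kl; apply: eq_card0 => -[u v]; rewrite !inE /=.
  apply/negbTE/and3P => -[/degE -> /eqP dk /eqP dl].
  by rewrite -dk -dl eqxx in neq_kl.
by rewrite /pair_count (negbTE neq_ij) !arc0 // eq_sym.
Qed.

Lemma sumr_arc_ge0_eq0 (F : numDomainType) (f : V * V -> F)
    (f_ge0 : forall uv, D uv.1 uv.2 -> 0 <= f uv)
    (f_eq0 : forall uv, D uv.1 uv.2 ->
       (f uv == 0) = (outdeg D uv.1 == indeg D uv.2)) :
  \sum_(uv | D uv.1 uv.2) f uv = 0 <->
    (forall u v : V, D u v -> outdeg D u = indeg D v).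
Proof.
split=> [/eqP | degE].
  rewrite psumr_eq0 // => /allP all0 u v Duv; apply/eqP.
  by have /implyP/(_ Duv) := all0 (u, v) (mem_index_enum _); rewrite f_eq0.
by apply: big1 => uv Duv; apply/eqP; rewrite f_eq0 // (degE _ _ Duv).
Qed.

(* Either part of the theorem is the instance [s = 1] or [s = -1]. *)
Lemma vdb_index_signed_decomposition (F : realFieldType) (n : nat)
    (cardV : #|V| = n) (phi : nat -> nat -> F) (s : F) :
  (forall i j : nat, S3 n i j -> 0 < s * (phi i j - vdb_M n phi i j)) ->
  (forall i : nat, (1 <= i <= n - 2)%N ->
     i%:R * phi i i = (n - 1)%:R * phi (n - 1)%N (n - 1)%N) ->
  let r := s * (2 * vdb_index D phi - (n - 1)%:R / 2 * phi (n - 1)%N (n - 1)%N *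
    (2 * n%:R - (zero_degree_count D)%:R)) in
  0 <= r /\ (r = 0 <-> forall u v : V, D u v -> outdeg D u = indeg D v).
Proof.
move=> S3pos diag r.
pose f (uv : V * V) := let i := outdeg D uv.1 in let j := indeg D uv.2 in
  s * (phi i j - vdb_M n phi i j).
have fP uv : D uv.1 uv.2 ->
    0 <= f uv /\ (f uv == 0) = (outdeg D uv.1 == indeg D uv.2).
  move=> Duv; rewrite /f /=.
  have := (outdeg_ltn uv.1, indeg_ltn uv.2, outdeg_gt0 Duv, indeg_gt0 Duv).
  set i := outdeg D uv.1; set j := indeg D uv.2.
  rewrite cardV => -[[[i_lt j_lt] i_gt0] j_gt0].
  case: (eqVneq i j) => [eq_ij | neq_ij]; last first.
    have S3ij : S3 n i j by rewrite /S3 neq_ij; lia.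
    by split; [exact/ltW/S3pos | rewrite gt_eqF // S3pos].
  (* For [i = j] the weight [vdb_M] reduces to (n - 1) phi_(n-1,n-1) / i, which is the value that
     the diagonal hypothesis prescribes. *)
  suff -> : phi i j = vdb_M n phi i j by rewrite subrr mulr0 lexx eqxx.
  rewrite -eq_ij /vdb_M; have i_neq0 : i%:R != 0 :> F by rewrite pnatr_eq0 -lt0n.
  apply: (mulfI i_neq0).
  have -> : i%:R * phi i i = (n - 1)%:R * phi (n - 1)%N (n - 1)%N.
    (* The diagonal hypothesis stops at [n - 2]; at [i = n - 1] the identity is trivial. *)
    case: (leqP i (n - 2)) => [i_le | i_gt]; first by apply: diag; lia.
    by have -> : i = (n - 1)%N by lia.
  by field.
have -> : r = \sum_(uv | D uv.1 uv.2) f uv.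
  (* Read backwards, the inverse-degree identity makes the term in 2 n - n_0 a sum over arcs, to be
     compared with the index arc by arc. *)
  rewrite /r -cardV -(sum_arc_inv_degrees F) /vdb_index mulVKf ?pnatr_eq0 //.
  rewrite mulr_sumr -sumrB mulr_sumr; apply: eq_bigr => uv _.
  by rewrite /f /vdb_M cardV; ring.
split; first by apply: sumr_ge0 => uv /fP[].
by apply: sumr_arc_ge0_eq0 => uv /fP[].
Qed.

End StrictDigraph.

Theorem theorem3 (R : realFieldType) (n : nat) (hn : (2 <= n)%N)
    (V : finType) (hV : #|V| = n) (D : strict_digraph V)
    (hD : forall u : V, ~~ isolated D u)
    (phi : nat -> nat -> R)
    (phi_sym : forall i j : nat, (1 <= i <= n - 1)%N -> (1 <= j <= n - 1)%N ->
       phi i j = phi j i)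
    (phi_pos : 0 < phi (n - 1)%N (n - 1)%N) :
  ((forall i j : nat, S3 n i j -> vdb_M n phi i j < phi i j) ->
   (forall i : nat, (1 <= i <= n - 2)%N ->
      i%:R * phi i i = (n - 1)%:R * phi (n - 1)%N (n - 1)%N) ->
   let bound := 4^-1 * n%:R * (n - 1)%:R * phi (n - 1)%N (n - 1)%N in
   [/\ bound <= vdb_index D phi,
       vdb_index D phi = bound <->
         (zero_degree_count D = n /\
          forall i j : nat, S3 n i j -> pair_count D i j = 0%N)
     & vdb_index D phi = bound <->
         ((forall u v : V, D u v -> outdeg D u = indeg D v) /\
          forall u : V, outdeg D u = 0%N \/ indeg D u = 0%N)])
  /\
  ((forall i j : nat, S3 n i j -> phi i j < vdb_M n phi i j) ->
   (forall i : nat, (1 <= i <= n - 2)%N ->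
      i%:R * phi i i = (n - 1)%:R * phi (n - 1)%N (n - 1)%N) ->
   let bound := 2^-1 * n%:R * (n - 1)%:R * phi (n - 1)%N (n - 1)%N in
   [/\ vdb_index D phi <= bound,
       vdb_index D phi = bound <->
         (zero_degree_count D = 0%N /\
          forall i j : nat, S3 n i j -> pair_count D i j = 0%N)
     & vdb_index D phi = bound <->
         ((forall u v : V, D u v -> outdeg D u = indeg D v) /\
          forall u : V, (0 < outdeg D u)%N /\ (0 < indeg D u)%N)]).
Proof.
set c := phi (n - 1)%N (n - 1)%N in phi_pos *.
have n1_gt0 : 0 < (n - 1)%:R :> R by rewrite ltr0n; lia.
(* Here [c] is phi_(n-1,n-1) alone, without the factor n - 1. Positivity of this product fixes the
   sign of the n_0 term in both gaps and allows cancelling its coefficient in the equality cases. *)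
have p_gt0 : 0 < (n - 1)%:R * c by rewrite mulr_gt0.
have z_le : (zero_degree_count D)%:R <= n%:R :> R.
  by rewrite ler_nat -hV zero_degree_count_leq.
have z_ge0 : 0 <= (zero_degree_count D)%:R :> R by rewrite ler0n.
have zE := zero_degree_count_eq_card hD; rewrite hV in zE.
have z0 := zero_degree_count_eq0 D; have pcE := pair_count_S3_eq0 D hV.
split=> hS3 hdiag bound.
- have := vdb_index_signed_decomposition D hV (s := 1) _ hdiag.
  set r := 1 * _ => -[|r_ge0 r0].
    by move=> i j /hS3; rewrite mul1r subr_gt0.
  (* Since 2 n - n_0 = n + (n - n_0), the part with n gives the bound. Twice the gap is then a sum
     of two nonnegative terms, and equality makes both vanish. *)
  have gapE : 2 * (vdb_index D phi - bound) =
      r + (n - 1)%:R * c / 2 * (n%:R - (zero_degree_count D)%:R).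
    by rewrite /r /bound -/c; field.
  clearbody r.
  have t_ge0 : 0 <= (n - 1)%:R * c / 2 * (n%:R - (zero_degree_count D)%:R).
    by rewrite mulr_ge0 ?subr_ge0 // divr_ge0 // ltW.
  have eqE : vdb_index D phi = bound <->
      zero_degree_count D = n /\ (forall u v, D u v -> outdeg D u = indeg D v).
    rewrite -r0; split=> [IE | [zn rz]].
      have [t0 ->] : (n - 1)%:R * c / 2 * (n%:R - (zero_degree_count D)%:R) = 0
          /\ r = 0 by rewrite IE in gapE; split; lra.
      split=> //; apply/eqP; rewrite -(eqr_nat R) eq_sym -subr_eq0.
      by move/eqP: t0; rewrite mulf_eq0 gt_eqF // divr_gt0.
    by rewrite zn rz subrr mulr0 in gapE; lra.
  split; first by lra.
  + by rewrite eqE pcE.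
  + by rewrite eqE zE; tauto.
- have := vdb_index_signed_decomposition D hV (s := -1) _ hdiag.
  set r := -1 * _ => -[|r_ge0 r0].
    by move=> i j /hS3; rewrite mulN1r opprB subr_gt0.
  (* Now the part with 2 n gives the bound, so the second nonnegative term is proportional to n_0
     and vanishes exactly when n_0 = 0. *)
  have gapE : 2 * (bound - vdb_index D phi) =
      r + (n - 1)%:R * c / 2 * (zero_degree_count D)%:R.
    by rewrite /r /bound -/c; field.
  clearbody r.
  have t_ge0 : 0 <= (n - 1)%:R * c / 2 * (zero_degree_count D)%:R.
    by rewrite mulr_ge0 // divr_ge0 // ltW.
  have eqE : vdb_index D phi = bound <->
      zero_degree_count D = 0%N /\ (forall u v, D u v -> outdeg D u = indeg D v).
    rewrite -r0; split=> [IE | [zn rz]].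
      have [t0 ->] : (n - 1)%:R * c / 2 * (zero_degree_count D)%:R = 0
          /\ r = 0 by rewrite IE in gapE; split; lra.
      split=> //; apply/eqP; rewrite -(eqr_nat R).
      by move/eqP: t0; rewrite mulf_eq0 gt_eqF // divr_gt0.
    by rewrite zn rz mulr0 in gapE; lra.
  split; first by lra.
  + by rewrite eqE pcE.
  + by rewrite eqE z0; tauto.
Qed.
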